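(* Let $\alpha=\alpha_0\alpha_1\alpha_2\ldots$ be an aperiodic sequence over a finite alphabet such that $\#\mathcal{A}_\alpha=\ell\ge 3$ and such that every letter of $\mathcal{A}_\alpha$ appears infinitely often in $\alpha$. Suppose there is an integer $m\ge 1$ such that, among the $m$ residues $\alpha^{(i)}=\alpha_i\alpha_{i+m}\alpha_{i+2m}\ldots$, $0\le i\le m-1$, one residue is a pattern Sturmian sequence over two letters and all other residues are constant. Then there exist $C\in\mathbb{N}$ with $C\ge \ell-2$ and $K\in\mathbb{N}$ such that $p^*_\alpha(k)=2k+C$ for all $k\ge K$.
   Context: $\mathbb{N}=\{1,2,\ldots\}$, $\mathbb{N}_0=\{0,1,2,\ldots\}$. A sequence over a finite alphabet $\mathcal{A}$ is $\alpha=\alpha_0\alpha_1\ldots\in\mathcal{A}^{\mathbb{N}_0}$; $\mathcal{A}_\alpha$ is the set of letters that occur in $\alpha$. The shift is $\sigma(\alpha_0\alpha_1\alpha_2\ldots)=\alpha_1\alpha_2\ldots$. A sequence is periodic if $\sigma^t(\alpha)=\alpha$ for some $t\in\mathbb{N}$, eventually periodic if some $\sigma^t(\alpha)$ is periodic, and aperiodic if it is neither periodic nor eventually periodic. A $k$-sized window is a set $\tau=\{0=\tau(0)<\tau(1)<\cdots<\tau(k-1)\}\subset\mathbb{N}_0$. For $n\in\mathbb{N}_0$ put $\alpha[n+\tau]=\alpha_{n+\tau(0)}\alpha_{n+\tau(1)}\ldots\alpha_{n+\tau(k-1)}$ and $F_\alpha(\tau)=\{\alpha[n+\tau]:n\in\mathbb{N}_0\}$.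 The maximal pattern complexity of $\alpha$ is $p^*_\alpha(k)=\sup_\tau \#F_\alpha(\tau)$, the supremum being over all $k$-sized windows $\tau$. A pattern Sturmian sequence over two letters is an aperiodic sequence $x$ over a two-letter alphabet with $p^*_x(k)=2k$ for all $k\in\mathbb{N}$. *)

(* Defs.v *)
From mathcomp Require Import all_boot all_order.
From mathcomp Require Import boolp classical_sets functions cardinality.

Set Implicit Arguments.
Unset Strict Implicit.
Unset Printing Implicit Defensive.

Local Open Scope classical_set_scope.
Local Open Scope nat_scope.

Section Sequences.
Context {A : Type}.
Implicit Types alpha : nat -> A.

Definition shift alpha : nat -> A := fun n => alpha n.+1.

Definition periodic alpha : Prop :=
  exists2 t, 0 < t & iter t shift alpha = alpha.

Definition eventually_periodic alpha : Prop :=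
  exists t, periodic (iter t shift alpha).

Definition aperiodic alpha : Prop :=
  ~ periodic alpha /\ ~ eventually_periodic alpha.

Definition residue (m i : nat) alpha : nat -> A := fun n => alpha (i + n * m).

End Sequences.

(* A k-sized window is the increasing enumeration of its elements; the
   condition on [ohead] says tau(0) = 0, so there is no window of size 0. *)
Definition is_window (k : nat) (tau : k.-tuple nat) : bool :=
  (ohead tau == Some 0) && sorted ltn tau.

Definition pattern {A : Type} (alpha : nat -> A) (k : nat)
    (tau : k.-tuple nat) (n : nat) : k.-tuple A :=
  [tuple alpha (n + tnth tau j) | j < k].

Definition patterns {A : Type} (alpha : nat -> A) (k : nat)
    (tau : k.-tuple nat) : set (k.-tuple A) :=
  range (pattern alpha tau).

(* The set below is bounded by #|A| ^ k, and nonempty when k > 0, so that the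
   default value 0 of [supremum] is irrelevant for k > 0. *)
Definition max_pattern_complexity {A : finType} (alpha : nat -> A) (k : nat)
    : nat :=
  supremum 0 [set #|patterns alpha tau| | tau in [set tau | @is_window k tau]].

Definition pattern_sturmian {A : finType} (x : nat -> A) : Prop :=
  [/\ exists2 B : {set A}, #|B| = 2 & forall n, x n \in B,
      aperiodic x
    & forall k, 0 < k -> max_pattern_complexity x k = 2 * k].

(* Main.v *)
Require Import Defs.
From mathcomp Require Import all_boot all_order.
From mathcomp Require Import boolp classical_sets functions cardinality.
From mathcomp Require Import zify.

(* Write p for the maximal pattern complexity.  The difference p(k) - 2k is
   nondecreasing, is at least l - 2 at k = 1, and is at most m; hence it is
   eventually constant.

   Upper bound: in a window of size k, the patterns read from positions
   congruent to r mod m depend only on the t_r entries that fall in the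
   Sturmian residue, so there are at most 2 t_r + 1 of them, and the t_r add up
   to k.

   Monotonicity: for any sequence that is not eventually periodic, any window
   can be extended by one far away position s that splits two distinct patterns.
   Take a recurrent limit point y of the sequence (a point of a minimal
   subshift).
   - If y is not eventually periodic, let s be a return time of y.  For at least
     two letters a, some occurrence of a in y is not followed by a at distance
     s, since otherwise the set of positions of the other letters would be
     stable under translation by s.  As y(n + s) = y(n) for all small n, a
     pattern starting with a is split, for each of these letters a.
   - If y is eventually periodic, the sequence x follows a periodic sequence z
     on arbitrarily long stretches, each ended by a mismatch at some b.  Take
     s = b - n.  If z(. + s) is not constant on the occurrences of some pattern,
     then s splits that pattern, and splitting no other forces it to be the
     pattern at n.  Otherwise s splits the pattern at n, and also the pattern at
     n + b' - b for each later mismatch b'; if these two always agree, taking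
     b' after a stretch longer than b gives x(n) = z(n).  So if two patterns are
     never split together, x is eventually periodic along each residue class
     of n modulo the period. *)

Set Implicit Arguments.
Unset Strict Implicit.
Unset Printing Implicit Defensive.

Local Open Scope classical_set_scope.
Local Open Scope nat_scope.

(** * Finiteness arguments and eventual periodicity *)

Lemma finite_pigeonhole (T : finType) (P : T -> nat -> Prop) :
  (forall c M N, M <= N -> P c N -> P c M) ->
  (forall N, exists c, P c N) -> exists c, forall N, P c N.
Proof.
move=> anti ex; apply: contrapT => /forallNP no.
have /choice[B hB] c : exists N, ~ P c N by apply/existsNP/no.
have [c Pc] := ex (\max_c B c).
by apply: (hB c); apply: anti Pc; exact: leq_bigmax.
Qed.

Lemma finite_bound (T : finType) (P : T -> nat -> Prop) :
  (forall c M N, M <= N -> P c M -> P c N) ->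
  (forall c, exists N, P c N) -> exists N, forall c, P c N.
Proof.
move=> mono /choice[B hB]; exists (\max_c B c) => c.
by apply: mono (hB c); exact: leq_bigmax.
Qed.

Lemma iter_shiftE (A : Type) (x : nat -> A) t n : iter t shift x n = x (t + n).
Proof. by elim: t n => [|t IH] n //=; rewrite /shift IH addnS. Qed.

Lemma eventually_periodicP (A : Type) (x : nat -> A) :
  eventually_periodic x <->
  exists N p, 0 < p /\ forall n, N <= n -> x (n + p) = x n.
Proof.
split=> [[N [p p0 per]]|[N [p [p0 per]]]].
  exists N, p; split => // n Nn.
  have := congr1 (fun y => y (n - N)) per.
  rewrite /= !iter_shiftE => e.
  by rewrite -[in RHS](subnKC Nn) -e; congr x; lia.
exists N, p => //; apply/funext => n.
by rewrite !iter_shiftE addnCA (addnC p) per // leq_addr.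
Qed.

Lemma eventually_periodic_residues (A : Type) (x : nat -> A) p : 0 < p ->
  (forall r, r < p -> exists N, forall n, N <= n -> n %% p = r ->
    x (n + p) = x n) ->
  eventually_periodic x.
Proof.
move=> p0 per.
have [||N hN] := @finite_bound 'I_p
  (fun r N => forall n, N <= n -> n %% p = r -> x (n + p) = x n).
- by move=> r M N MN hM n Nn; apply: hM; exact: leq_trans Nn.
- by move=> r; apply: per.
- apply/eventually_periodicP; exists N, p; split => // n Nn.
  exact: (hN (Ordinal (ltn_pmod n p0))).
Qed.

Lemma finite_representatives (T : finType) (f : nat -> T) :
  exists N, forall n, exists2 n0, n0 < N & f n0 = f n.
Proof.
have [||N hN] := @finite_bound T
  (fun c N => forall n, f n = c -> exists2 n0, n0 < N & f n0 = c).
- by move=> c M N MN hM n /hM[n0 n0M <-]; exists n0 => //; exact: leq_trans MN.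
- move=> c; have [[n0 <-]|no] := pselect (exists n, f n = c).
    by exists n0.+1 => n _; exists n0.
  by exists 0 => n fn; case: no; exists n.
- by exists N => n; apply: hN.
Qed.

(** * Splitting along a recurrent sequence *)

(* [f n] stands for the pattern of [x] read at position [n]. *)
Definition splits {A T : Type} (x : nat -> A) (f : nat -> T) (s : nat)
    (w : T) :=
  exists n n', [/\ f n = w, f n' = w & x (n + s) <> x (n' + s)].

Definition splits_two {A T : Type} (x : nat -> A) (f : nat -> T) (s : nat) :=
  exists w w', [/\ w <> w', splits x f s w & splits x f s w'].

Definition limit_point {A : Type} (x y : nat -> A) :=
  forall N, exists2 s, N <= s & forall n, n < N -> x (n + s) = y n.

Definition recurrent {A : Type} (x : nat -> A) := limit_point x x.

Lemma recurrent_splits_two (A : Type) (T : finType) (x : nat -> A)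
    (f : nat -> T) M :
  (forall n n', f n = f n' -> x n = x n') ->
  recurrent x -> ~ eventually_periodic x ->
  exists2 s, M <= s & splits_two x f s.
Proof.
move=> fx rec nper.
have [N0 reps] := finite_representatives f.
have [s sN ret] := rec (maxn N0 M.+1).
exists s; first by lia.
have split n : x (n + s) <> x n -> splits x f s (f n).
  move=> neq; have [n0 n0N fn0] := reps n.
  exists n, n0; split => //; rewrite (ret n0) ?(fx _ _ fn0) //; lia.
suff [n1 [n2 [d1 d2 d12]]] : exists n1 n2,
    [/\ x (n1 + s) <> x n1, x (n2 + s) <> x n2 & x n1 <> x n2].
  by exists (f n1), (f n2); split; [move/fx|exact: split|exact: split].
apply: contrapT => no; apply: nper.
have [[n1 d1]|no1] := pselect (exists n, x (n + s) <> x n); last first.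
  apply/eventually_periodicP; exists 0, s; split; first by lia.
  by move=> n _; apply: contrapT => d; apply: no1; exists n.
have stay n : x n <> x n1 -> x (n + s) = x n.
  move=> ne; apply: contrapT => d; apply: no; exists n, n1; split => //.
(* Only the letter [x n1] can change under translation by [s], so along a class modulo [s] any other
   letter, once it occurs, stays for ever. *)
apply: (@eventually_periodic_residues _ _ s); first by lia.
move=> r rs.
have [[n [nr ne]]|always] :=
    pselect (exists n, n %% s = r /\ x n <> x n1); last first.
  exists 0 => n _ nr; transitivity (x n1); last symmetry.
    by apply: contrapT => d; apply: always; exists (n + s); rewrite modnDr.
  by apply: contrapT => d; apply: always; exists n; split => // e; apply: d.
exists n => n' nn' n'r.
have: exists q, n' = n + q * s.
  exists ((n' - n) %/ s); rewrite divnK; first by rewrite subnKC.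
  by rewrite -eqn_mod_dvd // nr n'r.
move=> [q ->] {nn' n'r}; apply: (stay).
suff -> : x (n + q * s) = x n by [].
elim: q => [|q IH]; first by rewrite addn0.
by rewrite -[RHS]IH mulSn (addnC s) addnA stay // IH.
Qed.

(** * Splitting along a periodic limit point *)

Lemma periodic_add_mul (A : Type) (y : nat -> A) p q n :
  (forall n, y (n + p) = y n) -> y (n + q * p) = y n.
Proof.
move=> per; elim: q => [|q IH]; first by rewrite addn0.
by rewrite mulSn (addnC p) addnA per.
Qed.

Lemma periodic_mod (A : Type) (y : nat -> A) p m n :
  (forall n, y (n + p) = y n) -> m = n %[mod p] -> y m = y n.
Proof.
move=> per mn.
have red k : y k = y (k %% p).
  by rewrite [in LHS](divn_eq k p) addnC periodic_add_mul.
by rewrite red mn -red.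
Qed.

(** With [2 * N <= b] the subtraction is exact and the stretch of agreement starts no earlier than
    [N]. *)
Definition mismatches {A : Type} (x y : nat -> A) p r :=
  forall N, exists b, [/\ 2 * N <= b, b %% p = r, x b <> y b &
    forall n, b - N <= n -> n < b -> x n = y n].

(** The first mismatch after a copy of [y] ends a long stretch. The phase of the copy and the
    residue of the mismatch take finitely many values, so one pair serves all [N]. *)
Lemma limit_point_mismatches (A : Type) (x y : nat -> A) p : 0 < p ->
  (forall n, y (n + p) = y n) -> limit_point x y -> ~ eventually_periodic x ->
  exists z r, (forall n, z (n + p) = z n) /\ mismatches x z p r.
Proof.
move=> p0 per lim nper.
have [||[u r] ur] := @finite_pigeonhole ('I_p * 'I_p)%type
  (fun c N => exists b, [/\ 2 * N <= b, b %% p = c.2, x b <> y (b + c.1) &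
    forall n, b - N <= n -> n < b -> x n = y (n + c.1)]).
- move=> c M N MN [b [bN br ne eq]]; exists b; split => //; first by lia.
  by move=> n nM nb; apply: eq; lia.
- move=> N; have [s sN sy] := lim (2 * N).
  (* The shift by [u] aligns [y] with absolute positions in [x]. *)
  pose u := (p - s %% p) %% p.
  have us : s + u = 0 %[mod p].
    rewrite /u modnDmr -modnDml subnKC ?modnn ?mod0n //.
    exact/ltnW/ltn_pmod.
  have yu n : y (s + n + u) = y n.
    by apply: (periodic_mod per); rewrite addnAC -modnDml us mod0n.
  have ltu : u < p by exact: ltn_pmod.
  move: u ltu yu {us} => u ltu yu.
  have [b] : exists b, s <= b /\ x b <> y (b + u).
    apply: contrapT => no; apply: nper; apply/eventually_periodicP.
    exists s, p; split => // n sn.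
    have eq m : s <= m -> x m = y (m + u).
      by move=> sm; apply: contrapT => ne; apply: no; exists m.
    by rewrite (eq n sn) eq ?(leq_trans sn) ?leq_addr // addnAC per.
  move=> bs; pose Q b := `[< s <= b /\ x b <> y (b + u) >].
  have exQ : exists b, Q b by exists b; apply/asboolP.
  case: (ex_minnP exQ) => {}b /asboolP[{}bs ne] min.
  have eq n : s <= n -> n < b -> x n = y (n + u).
    move=> sn nb; apply: contrapT => d.
    by have := min n; rewrite leqNgt nb => /(_ (asboolT (conj sn d))).
  have bN : s + 2 * N <= b.
    rewrite leqNgt; apply/negP => lt; apply: ne.
    have -> : b = s + (b - s) by lia.
    by rewrite yu -sy 1?addnC //; lia.
  exists (Ordinal ltu, Ordinal (ltn_pmod b p0)), b; split => //=; first by lia.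
  by move=> n nN nb; apply: eq => //; lia.
- exists (fun n => y (n + u)), r; split=> [n|N]; first by rewrite addnAC per.
  exact: ur.
Qed.

Lemma mismatches_splits_two (A : Type) (T : finType) (x y : nat -> A)
    (f : nat -> T) p r M : 0 < p ->
  (forall n n', f n = f n' -> x n = x n') ->
  (forall n, y (n + p) = y n) -> mismatches x y p r ->
  ~ eventually_periodic x ->
  exists2 s, M <= s & splits_two x f s.
Proof.
move=> p0 fx per mis nper; apply: contrapT => none; apply: nper.
have uniq s w w' : M <= s -> splits x f s w -> splits x f s w' -> w = w'.
  move=> Ms sw sw'; apply: contrapT => ww'.
  by apply: none; exists s => //; exists w, w'.
have [N0 reps] := finite_representatives f.
apply: (eventually_periodic_residues p0) => c cp.
(* [e] represents [r - c] modulo [p]: for [n] in class [c] and [b] in class [r], translation by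
   [b - n] acts on [y] as translation by [e]. *)
pose e := r + (p - c).
have ne n b : n %% p = c -> b %% p = r -> n + e = b %[mod p].
  move=> nc br; rewrite /e -modnDml nc addnCA subnKC; last exact: ltnW.
  by rewrite modnDr -br modn_mod.
have ye n b n' : n %% p = c -> b %% p = r -> n <= b ->
    y (n' + (b - n)) = y (n' + e).
  move=> nc br nb; apply: (periodic_mod per); apply/eqP.
  by rewrite eqn_modDl -(eqn_modDl n) subnKC //; apply/eqP; rewrite (ne n b).
have yb n b : n %% p = c -> b %% p = r -> y (n + e) = y b.
  by move=> nc br; apply: (periodic_mod per); exact: ne.
clearbody e.
have [[n1 [n1' [fn1 yn1]]]|const] := pselect (exists n1 n1',
    f n1 = f n1' /\ y (n1 + e) <> y (n1' + e)).
- suff fc n : N0 + n1 + n1' <= n -> n %% p = c -> f n = f n1.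
    exists (N0 + n1 + n1') => n Nn nc; apply: fx.
    by rewrite !fc // ?modnDr // (leq_trans Nn) // leq_addr.
  move=> Nn nc; have [n0 n0N fn0] := reps n.
  have [b [bN br nb eq]] := mis (n + p + M).
  (* If the values of [y] agree, [b - n] puts [n] on the mismatch and [n0] inside the stretch. If
     they differ, going one more period back puts both inside, where [x] follows [y]. *)
  have [e0|d0] := pselect (y (n0 + e) = y (n + e)).
    have xe n' : n' < n -> x (n' + (b - n)) = y (n' + e).
      by move=> n'n; rewrite eq -?(ye n b) //; lia.
    apply: (uniq (b - n)); first by lia.
      exists n, n0; split => //; rewrite (xe n0); last by lia.
      by rewrite e0 (yb n b) // subnKC //; lia.
    by exists n1, n1'; split => //; rewrite !xe //; lia.
  have xe n' : n' <= n -> x (n' + (b - (n + p))) = y (n' + e).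
    by move=> n'n; rewrite eq -?(ye (n + p) b) ?modnDr //; lia.
  apply: (uniq (b - (n + p))); first by lia.
    by exists n0, n; split => //; rewrite !xe //; lia.
  by exists n1, n1'; split => //; rewrite !xe //; lia.
have cst n n' : f n = f n' -> y (n + e) = y (n' + e).
  by move=> fn; apply: contrapT => d; apply: const; exists n, n'.
suff xy n : N0 <= n -> n %% p = c -> x n = y n.
  exists N0 => n Nn nc.
  by rewrite !xy ?per ?modnDr // (leq_trans Nn) // leq_addr.
move=> Nn nc.
have [b [bN br nb eq]] := mis (n + M + 1).
have [b' [bN' br' nb' eq']] := mis (b + 1).
(* [n'] lands on a mismatch [d], while its representative [n0 < N0 <= n] lands in the stretch before
   [b], where [x] takes the value [y d]. *)
have split n' d : d %% p = r -> n' + (b - n) = d -> x d <> y d ->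
    splits x f (b - n) (f n').
  move=> dr n'd nd; have [n0 n0N fn0] := reps n'.
  exists n', n0; split => //; rewrite n'd (eq (n0 + (b - n))); [|lia|lia].
  rewrite (ye n b) //; last by lia.
  by rewrite (cst _ _ fn0) -(ye n b) ?n'd //; lia.
have fn : f n = f (n + (b' - b)).
  apply: (uniq (b - n)); first by lia.
    by apply: (split _ b) => //; lia.
  by apply: (split _ b') => //; lia.
rewrite (fx _ _ fn) eq'; [|lia|lia].
apply: (periodic_mod per); apply/eqP.
rewrite -[X in _ == X %[mod p]]addn0 eqn_modDl -(eqn_modDl b) addn0.
by rewrite subnKC ?br ?br' //; lia.
Qed.

(** * Words, avoidable sets and minimal subshifts *)

Definition factor {A : Type} (x : nat -> A) (n k : nat) : seq A :=
  mkseq (fun i => x (n + i)) k.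

Lemma size_factor (A : Type) (x : nat -> A) n k : size (factor x n k) = k.
Proof. exact: size_mkseq. Qed.

Lemma factorS (A : Type) (x : nat -> A) n k :
  factor x n k.+1 = rcons (factor x n k) (x (n + k)).
Proof. by rewrite /factor /mkseq -addn1 iotaD map_cat cats1. Qed.

Lemma factorP (A : Type) (x y : nat -> A) m n k :
  factor x m k = factor y n k <-> forall i, i < k -> x (m + i) = y (n + i).
Proof.
split=> [e i ik|e].
  have := congr1 (fun u => nth (x 0) u i) e.
  by rewrite !nth_mkseq.
by apply: (@eq_from_nth _ (x 0)); rewrite !size_mkseq // => i ik;
  rewrite !nth_mkseq // e.
Qed.

Definition avoids {A : Type} (x : nat -> A) (P : set (seq A)) (n N : nat) :=
  forall i k, i + k <= N -> ~ P (factor x (n + i) k).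

(** Over a finite alphabet this says, by compactness, that some limit point of [x] has no factor in
    [P]. *)
Definition avoidable {A : Type} (x : nat -> A) (P : set (seq A)) :=
  forall N, exists2 n, N <= n & avoids x P n N.

Lemma total_bigcup_subseq (T : eqType) (F : set (set T)) (X0 : set T)
    (s : seq T) :
  F X0 -> total_on F subset ->
  exists2 X, F X & forall u, u \in s -> (\bigcup_(Y in F) Y) u -> X u.
Proof.
move=> FX0 tot; elim: s => [|v s [X FX IH]]; first by exists X0.
have [[Y FY Yv]|no] := pselect ((\bigcup_(Y in F) Y) v); last first.
  by exists X => // u; rewrite inE => /orP[/eqP->|/IH].
have [XY|YX] := tot _ _ FX FY.
  by exists Y => // u; rewrite inE => /orP[/eqP->|/IH /[apply] /XY].
by exists X => // u; rewrite inE => /orP[/eqP-> _|/IH //]; exact: YX.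
Qed.

(** At stage [N] only the finitely many words of length at most [N] matter, and one member of the
    chain contains all of those in the union. *)
Lemma avoidable_bigcup (A : finType) (x : nat -> A) (F : set (set (seq A))) :
  F `<=` avoidable x -> total_on F subset ->
  avoidable x (\bigcup_(X in F) X).
Proof.
move=> Fav tot N.
have [->|/set0P[X0 FX0]] := eqVneq F set0.
  by exists N => // i k _; rewrite bigcup_set0.
pose s := [seq tval u | k <- iota 0 N.+1, u <- enum {: k.-tuple A}].
have [X FX Xs] := total_bigcup_subseq s FX0 tot.
have [n Nn av] := Fav _ FX N; exists n => // i k ikN.
move/Xs => /(_ _)/av; apply => //.
apply/allpairsPdep; exists k, [tuple x (n + i + j) | j < k].
rewrite mem_iota mem_enum; split => //; first by lia.
apply: (@eq_from_nth _ (x 0)); rewrite size_factor ?size_tuple // => j jk.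
by rewrite nth_mkseq // -[j]/(nat_of_ord (Ordinal jk)) -tnth_nth tnth_mktuple.
Qed.

(* A maximal avoidable set of words is the complement of the language of a
   minimal subshift in the orbit closure of [x]. *)
Lemma maximal_avoidable (A : finType) (x : nat -> A) :
  exists P, avoidable x P /\
    forall u, P u \/ exists N, forall n, N <= n -> avoids x P n N ->
      exists i, i + size u <= N /\ factor x (n + i) (size u) = u.
Proof.
have [P [Pav max]] := Zorn_bigcup (@avoidable_bigcup A x).
exists P; split=> // u; have [Pu|nPu] := pselect (P u); [by left|right].
(* By maximality [u] cannot be added to [P]; the stage at which avoidance of the larger set fails
   bounds the wait for [u]. *)
have /existsNP[N no] : ~ avoidable x (P `|` [set u]).
  apply: max; split; first by move=> v; left.
  by move=> /(_ u) sub; apply/nPu/sub; right.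
exists N => n Nn av; apply: contrapT => nou; apply: no; exists n => // i k ikN.
case=> [|uE]; first exact: av.
by apply: nou; exists i; rewrite -uE size_factor.
Qed.

(** Words that begin far, long stretches avoiding [P] extend letter by letter, by the pigeonhole
    principle, to a limit point [y]. Its prefixes are not in [P], so by maximality they reappear in
    every long enough avoiding stretch. *)
Lemma recurrent_limit_point (A : finType) (x : nat -> A) :
  exists y, limit_point x y /\ recurrent y.
Proof.
have [P [Pav max]] := maximal_avoidable x.
pose good u := forall N, exists n,
  [/\ N <= n, avoids x P n N & factor x n (size u) = u].
have next u : exists a, good u -> good (rcons u a).
  have [gu|] := pselect (good u); last by exists (x 0).
  have [||a ha] := @finite_pigeonhole A (fun a N => exists n,
    [/\ N <= n, avoids x P n N & factor x n (size (rcons u a)) = rcons u a]).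
  - move=> a M N MN [n [Nn av e]]; exists n; split=> //; first by lia.
    by move=> i k ik; apply: av; lia.
  - move=> N; have [n [Nn av e]] := gu N; exists (x (n + size u)), n.
    by split=> //; rewrite size_rcons factorS e.
  - by exists a.
have [g hg] := choice next.
pose pre k := iter k (fun u => rcons u (g u)) [::].
have size_pre k : size (pre k) = k.
  by elim: k => //= k IH; rewrite size_rcons IH.
pose y k := g (pre k).
have preE k : pre k = factor y 0 k.
  by elim: k => [//|k IH]; rewrite factorS -IH.
have good_pre k : good (pre k).
  elim: k => [|k IH]; last exact: hg.
  by move=> N; have [n Nn av] := Pav N; exists n.
have lim N k : exists n, [/\ N <= n, avoids x P n N &
    forall i, i < k -> x (n + i) = y i].
  have [n [Nn av e]] := good_pre k N; exists n; split=> //.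
  by move: e; rewrite size_pre preE => /factorP.
exists y; split=> N.
  by have [n [Nn _ e]] := lim N N; exists n => // i; rewrite addnC; exact: e.
have nPu : ~ P (pre N).
  have [n [_ av e]] := lim N N.
  suff -> : pre N = factor x (n + 0) N by apply: av.
  by rewrite preE; apply/factorP => i iN; rewrite addn0 e.
have [//|[L hL]] := max (pre N).
have [n [Nn av e]] := lim (N + L) (N + L + N).
(* Searching from [n + N] on makes the return time [N + i] at least [N]. *)
have [||i []] := hL (n + N); first by lia.
  by move=> i k ik; rewrite -addnA; apply: av; lia.
rewrite size_pre preE => iL /factorP f.
exists (N + i); first by lia.
move=> j jN; have := f j jN; rewrite add0n => <-.
by rewrite -(e (j + (N + i))); [congr x|]; lia.
Qed.

(** * Counting patterns and extending windows *)

Lemma range_section (T : finType) (f : nat -> T) :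
  exists h : T -> nat, forall n, f (h (f n)) = f n.
Proof.
have /choice[h hE] t : exists n, forall n', f n' = t -> f n = t.
  have [[n fn]|no] := pselect (exists n, f n = t); first by exists n.
  by exists 0 => n' fn'; case: no; exists n'.
by exists h => n; apply: (hE (f n) n).
Qed.

Lemma leq_card_range (S T : finType) (f : nat -> S) (g : nat -> T) :
  (forall n n', g n = g n' -> f n = f n') -> #|range f| <= #|range g|.
Proof.
move=> fg; have [h hE] := range_section g.
have le := @leq_image_card T S (fun t => f (h t)) (mem (range g)).
apply: leq_trans le; apply/subset_leq_card/fintype.subsetP => s.
rewrite in_setE => -[n _ <-].
have -> : f n = f (h (g n)) by apply: fg; rewrite hE.
by apply/mapP; exists (g n) => //; rewrite mem_enum; apply: mem_set; exists n.
Qed.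

(** A section of [f] gives one value of [g] per value of [f], and each of the two split values has a
    further one off the section. *)
Lemma card_range_split_two (S T : finType) (f : nat -> S) (g : nat -> T) :
  (forall n n', g n = g n' -> f n = f n') ->
  (exists w w', [/\ w <> w',
    exists n n', [/\ f n = w, f n' = w & g n <> g n'] &
    exists n n', [/\ f n = w', f n' = w' & g n <> g n']]) ->
  #|range f| + 2 <= #|range g|.
Proof.
move=> fg [w [w' [ww' split split']]]; have [h hE] := range_section f.
have extra v : (exists n n', [/\ f n = v, f n' = v & g n <> g n']) ->
    exists n, f n = v /\ g n <> g (h v).
  move=> [n [n' [fn fn' d]]]; have [e|] := eqVneq (g n) (g (h v)).
    by exists n'; split => // e'; apply: d; rewrite e e'.
  by move/eqP => ?; exists n.
have [n [fn gn]] := extra _ split; have [n' [fn' gn']] := extra _ split'.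
pose s := [:: g n, g n' & [seq g (h t) | t in range f]].
have hf t : t \in range f -> f (h t) = t.
  by rewrite in_setE => -[p _ <-]; exact: hE.
have new p v : f p = v -> g p <> g (h v) ->
    g p \notin [seq g (h t) | t in range f].
  move=> fp d; apply/mapP => -[t]; rewrite mem_enum => tf e; apply: d.
  by rewrite e; move: (fg _ _ e); rewrite fp hf // => ->.
have /card_uniqP es : uniq s.
  rewrite /= inE negb_or (new _ _ fn gn) (new _ _ fn' gn') andbT /=.
  apply/andP; split; first by apply/eqP => /fg; rewrite fn fn'.
  rewrite map_inj_in_uniq ?enum_uniq // => t t'; rewrite !mem_enum => tf t'f.
  by move/fg; rewrite !hf.
have : #|s| <= #|range g|.
  apply/subset_leq_card/fintype.subsetP => t.
  move=> ts; apply: mem_set; move: ts.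
  rewrite !inE => /or3P[/eqP->|/eqP->|/mapP[v _ ->]].
  - by exists n.
  - by exists n'.
  - by exists (h v).
by rewrite es /= size_map -cardE addn2.
Qed.

Lemma eq_pattern (A : Type) (x y : nat -> A) k (tau : k.-tuple nat) n n' :
  pattern x tau n = pattern y tau n' <->
  forall j, j \in (tau : seq nat) -> x (n + j) = y (n' + j).
Proof.
split=> [e j /tnthP[i ->]|e].
  by have := congr1 (fun t => tnth t i) e; rewrite !tnth_mktuple.
by apply: eq_from_tnth => i; rewrite !tnth_mktuple e ?mem_tnth.
Qed.

Lemma window_extension (A : finType) (alpha : nat -> A) k (tau : k.-tuple nat) :
  ~ eventually_periodic alpha -> is_window tau ->
  exists2 tau' : k.+1.-tuple nat, is_window tau' &
    #|patterns alpha tau| + 2 <= #|patterns alpha tau'|.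
Proof.
move=> nper /andP[/eqP tau0 sorted_tau].
have tau_mem0 : 0 \in (tau : seq nat).
  by case: (tval tau) tau0 => // a t [->]; rewrite inE eqxx.
have pat0 (x : nat -> A) n n' :
    pattern x tau n = pattern x tau n' -> x n = x n'.
  by move/eq_pattern => /(_ 0 tau_mem0); rewrite !addn0.
pose M := (\max_(j <- tau) j).+1.
have ltM j : j \in (tau : seq nat) -> j < M.
  by move=> jtau; rewrite ltnS; apply: leq_bigmax_seq.
have [s Ms split] : exists2 s, M <= s & splits_two alpha (pattern alpha tau) s.
  have [y [lim rec]] := recurrent_limit_point alpha.
  have [/eventually_periodicP[N [p [p0 per]]]|npery] :=
      pselect (eventually_periodic y).
    (* Dropping the first [N] letters of [y] makes it periodic from the start and keeps it a limit
       point. *)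
    have lim' : limit_point alpha (fun n => y (n + N)).
      move=> L; have [s sL e] := lim (L + N); exists (s + N); first by lia.
      by move=> n nL; rewrite -e; [congr alpha|]; lia.
    have per' n : y (n + p + N) = y (n + N).
      by rewrite addnAC per // leq_addl.
    have [z [r [perz mis]]] := limit_point_mismatches p0 per' lim' nper.
    exact: (mismatches_splits_two M p0 (pat0 alpha) perz mis nper).
  have [s Ms [w [w' [ww' [n1 [n1' [e1 e1' d1]]] [n2 [n2' [e2 e2' d2]]]]]]] :=
    recurrent_splits_two M (pat0 y) rec npery.
  exists s => //.
  have [q _ qe] := lim (n1 + n1' + n2 + n2' + s + M).
  have qx n : n <= n1 + n1' + n2 + n2' + s -> alpha (q + n) = y n.
    by move=> ?; rewrite addnC qe //; lia.
  have pq n : n <= n1 + n1' + n2 + n2' ->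
      pattern alpha tau (q + n) = pattern y tau n.
    move=> nle; apply/eq_pattern => j /ltM jM.
    by rewrite -addnA qx //; lia.
  exists w, w'; split => //.
    exists (q + n1), (q + n1'); split; rewrite ?pq //; try by lia.
    by rewrite -!addnA !qx //; lia.
  exists (q + n2), (q + n2'); split; rewrite ?pq //; try by lia.
  by rewrite -!addnA !qx //; lia.
exists [tuple of rcons tau s].
  rewrite /is_window /=.
  case: (tval tau) tau0 sorted_tau ltM => //= a t [->] st ltM.
  rewrite eqxx rcons_path st /=.
  exact: leq_trans (ltM _ (mem_last _ _)) Ms.
apply: card_range_split_two => [n n' /eq_pattern e|].
  by apply/eq_pattern => j jt; apply: e; rewrite mem_rcons inE jt orbT.
have [w [w' [ww' [n1 [n1' [e1 e1' d1]]] [n2 [n2' [e2 e2' d2]]]]]] := split.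
have stau : s \in [tuple of rcons tau s] by rewrite mem_rcons mem_head.
exists w, w'; split=> //.
  by exists n1, n1'; split => // /eq_pattern/(_ _ stau).
by exists n2, n2'; split => // /eq_pattern/(_ _ stau).
Qed.

(** * Attained suprema and the upper bound *)

Lemma supremum_nat (S : set nat) a b : S a -> ubound S b ->
  S (supremum 0 S) /\ ubound S (supremum 0 S).
Proof.
move=> Sa Sb; have Sn0 : supremums S !=set0.
  by apply: nat_supremums_neq0; exists b.
have [ub lub] : supremums S (supremum 0 S).
  rewrite /supremum ifF; first exact: xgetPex.
  by apply/eqP => S0; rewrite S0 in Sa.
split=> //; apply: contrapT => notS.
(* A supremum outside [S] could be lowered by one. *)
suff : ubound S (supremum 0 S).-1.
  move/lub; rewrite leEnat; have := ub _ Sa; rewrite leEnat.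
  have : supremum 0 S <> a by move=> e; rewrite e in notS.
  lia.
move=> c Sc; have := ub _ Sc; rewrite !leEnat.
have : supremum 0 S <> c by move=> e; rewrite e in notS.
lia.
Qed.

Lemma max_pattern_complexityP (A : finType) (x : nat -> A) k : 0 < k ->
  (exists2 tau : k.-tuple nat, is_window tau &
    #|patterns x tau| = max_pattern_complexity x k) /\
  forall tau : k.-tuple nat, is_window tau ->
    #|patterns x tau| <= max_pattern_complexity x k.
Proof.
move=> k0.
pose S := [set #|patterns x tau| | tau in [set tau | @is_window k tau]].
have w0 : is_window [tuple of iota 0 k].
  by rewrite /is_window iota_ltn_sorted; case: k k0 {S}.
have [[tau wtau eS] ub] : S (supremum 0 S) /\ ubound S (supremum 0 S).
  apply: (@supremum_nat S _ #|{: k.-tuple A}|).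
    by exists [tuple of iota 0 k].
  by move=> _ [tau _ <-]; exact: max_card.
split; first by exists tau.
by move=> tau' w'; apply: ub; exists tau'.
Qed.

(** Sorting [u], removing duplicates and translating its least entry to [0] gives a window. The
    [+ 1] covers empty [u], where [f] is constant and no window of size [0] exists. *)
Lemma card_range_window (A T : finType) (x : nat -> A) (f : nat -> T)
    (u : seq nat) :
  (forall k, 0 < k -> max_pattern_complexity x k = 2 * k) ->
  (forall n n', (forall j, j \in u -> x (n + j) = x (n' + j)) -> f n = f n') ->
  #|range f| <= 2 * size u + 1.
Proof.
move=> xk fu.
pose v := sort leq (undup u).
have vu : v =i u by move=> j; rewrite mem_sort mem_undup.
have sv : size v <= size u by rewrite size_sort size_undup.
have sorted_v : sorted ltn v.
  rewrite ltn_sorted_uniq_leq sort_uniq undup_uniq.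
  by rewrite sort_sorted //; exact: leq_total.
case: v vu sv sorted_v => [|a t] vu sv sorted_v.
  apply: (@leq_trans #|range (fun _ : nat => tt)|).
    by apply: leq_card_range => n n' _; apply: fu => j; rewrite -vu.
  by apply: leq_trans (max_card _) _; rewrite card_unit; lia.
pose w := in_tuple [seq j - a | j <- a :: t].
have ge_a j : j \in a :: t -> a <= j.
  rewrite inE => /orP[/eqP->//|jt].
  by have /(order_path_min ltn_trans)/allP/(_ _ jt)/ltnW := sorted_v.
have ww : is_window w.
  rewrite /is_window /= subnn eqxx /=.
  have : sorted ltn [seq j - a | j <- a :: t].
    apply: (homo_sorted_in (P := fun j => a <= j)) sorted_v.
      by move=> i j; rewrite -!topredE /=; lia.
    exact/allP.
  by rewrite /= subnn.
apply: (@leq_trans #|patterns x w|).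
  apply: (@leq_trans #|range (fun n => pattern x w (n + a))|).
    apply: leq_card_range => n n' /eq_pattern e; apply: fu => j.
    rewrite -vu => jv; have jw : j - a \in tval w by apply/mapP; exists j.
    by have := e _ jw; rewrite -!addnA !subnKC ?ge_a.
  apply/subset_leq_card/fintype.subsetP => s; rewrite !in_setE => -[n _ <-].
  by exists (n + a).
have [_ /(_ _ ww)] :=
  @max_pattern_complexityP A x (size [seq j - a | j <- a :: t]) isT.
rewrite xk // => le; apply: leq_trans le _.
by rewrite size_map; lia.
Qed.

Lemma card_cover_le (I T : finType) (X : {pred T}) (Y : I -> {pred T}) :
  (forall t, t \in X -> exists i, t \in Y i) -> #|X| <= \sum_i #|Y i|.
Proof.
move=> cover; have cardE' (Z : {pred T}) : #|Z| = \sum_t (t \in Z).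
  by rewrite -sum1_card big_mkcond.
rewrite cardE' (eq_bigr (fun i => \sum_t (t \in Y i)))//.
rewrite exchange_big; apply: leq_sum => t _.
case: (boolP (t \in X)) => // /cover[i ti].
by rewrite (bigD1 i) //= ti.
Qed.

Lemma max_pattern_complexity_residues (A : finType) (alpha : nat -> A) m
    (i : 'I_m) :
  (forall k, 0 < k -> max_pattern_complexity (residue m i alpha) k = 2 * k) ->
  (forall j : 'I_m, j != i -> exists a, forall n, residue m j alpha n = a) ->
  forall k, 0 < k -> max_pattern_complexity alpha k <= 2 * k + m.
Proof.
move=> sturm const k k0; have m0 : 0 < m by case: (i) => j; lia.
have [[tau _ <-] _] := max_pattern_complexityP alpha k0.
pose u r := [seq (r + j) %/ m | j <- tau & (r + j) %% m == i].
pose f (r : 'I_m) n := pattern alpha tau (r + n * m).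
have cardf r : #|range (f r)| <= 2 * size (u r) + 1.
  apply: (card_range_window sturm) => n n' e; apply/eq_pattern => j jtau.
  have split p : alpha (r + p * m + j) =
      residue m ((r + j) %% m) alpha (p + (r + j) %/ m).
    rewrite /residue; congr alpha.
    by rewrite mulnDl addnCA (addnC (_ %% m)) -divn_eq addnCA addnA.
  rewrite !split.
  have [ri|ri] := eqVneq ((r + j) %% m) i.
    by rewrite ri e //; apply/mapP; exists j => //; rewrite mem_filter ri eqxx.
  have [a ha] := const (Ordinal (ltn_pmod (r + j) m0)) ri.
  by rewrite (ha _) (ha (n' + _)).
apply: (@leq_trans (\sum_(r < m) #|range (f r)|)).
  apply: card_cover_le => t; rewrite in_setE => -[n _ <-].
  exists (Ordinal (ltn_pmod n m0)); apply: mem_set; exists (n %/ m) => //.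
  by rewrite /f /= addnC -divn_eq.
apply: (@leq_trans (\sum_(r < m) (2 * size (u r) + 1))).
  by apply: leq_sum => r _; exact: cardf.
rewrite big_split /= sum1_card card_ord leq_add2r -big_distrr /= leq_mul2l /=.
rewrite -[leqRHS](size_tuple tau).
under eq_bigr do rewrite size_map size_filter -sum1_count big_mkcond /=.
(* Counting by entries [j] of the window: at most one [r < m] has [r + j] congruent to [i]. *)
rewrite exchange_big -sum1_size /=; apply: leq_sum => j _.
rewrite -big_mkcond sum1_card /=; apply/card_le1_eqP => r r'.
rewrite -!topredE /= => /eqP ri /eqP r'i; apply: val_inj.
have : r + j = r' + j %[mod m] by rewrite ri r'i.
by move/eqP; rewrite eqn_modDr !modn_small // => /eqP.
Qed.

(** * Stabilisation of the difference *)

Lemma nondecreasing_bounded_eventually_constant (g : nat -> nat) b :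
  (forall n, 0 < n -> g n <= g n.+1) -> (forall n, 0 < n -> g n <= b) ->
  exists C K, [/\ 0 < K, g 1 <= C & forall n, K <= n -> g n = C].
Proof.
move=> nd bd.
have mono p n : 0 < p -> p <= n -> g p <= g n.
  move=> p0 /subnKC <-; elim: (n - p) => [|q IH]; first by rewrite addn0.
  by rewrite addnS; apply: leq_trans IH (nd _ _); lia.
have exP : exists C, `[< exists2 K, 0 < K & g K = C >].
  by exists (g 1); apply/asboolP; exists 1.
have bdP C : `[< exists2 K, 0 < K & g K = C >] -> C <= b.
  by move=> /asboolP[K K0 <-]; exact: bd.
case: (ex_maxnP exP bdP) => C /asboolP[K K0 gK] max.
exists C, K; split => // [|n Kn].
  by apply: max; apply/asboolP; exists 1.
apply/eqP; rewrite eqn_leq -{2}gK mono // andbT.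
by apply: max; apply/asboolP; exists n => //; exact: leq_trans Kn.
Qed.

Lemma max_pattern_complexity1 (A : finType) (alpha : nat -> A) :
  #|range alpha| <= max_pattern_complexity alpha 1.
Proof.
have [_ /(_ [tuple 0] isT)] := @max_pattern_complexityP A alpha 1 isT.
apply: leq_trans; apply: leq_card_range => n n' /eq_pattern/(_ 0).
by rewrite !addn0; apply; rewrite inE.
Qed.

Theorem theorem1p3 (A : finType) (alpha : nat -> A) (l : nat)
    (alpha_aperiodic : aperiodic alpha)
    (card_letters : #|range alpha| = l) (l_ge3 : 3 <= l)
    (letters_infinite :
      forall a, range alpha a -> infinite_set [set n | alpha n = a])
    (residues :
      exists m : nat, 0 < m /\
        exists i : 'I_m, pattern_sturmian (residue m i alpha) /\
          forall j : 'I_m, j != i -> exists a, forall n, residue m j alpha n = a) :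
  exists C K : nat,
    [/\ 0 < C, l - 2 <= C, 0 < K
      & forall k, K <= k -> max_pattern_complexity alpha k = 2 * k + C].
Proof.
have [m [m0 [i [[_ _ sturm] const]]]] := residues.
have [_ nper] := alpha_aperiodic.
have upper := max_pattern_complexity_residues sturm const.
have step k : 0 < k ->
    max_pattern_complexity alpha k + 2 <= max_pattern_complexity alpha k.+1.
  move=> k0; have [[tau wtau <-] _] := max_pattern_complexityP alpha k0.
  have [tau' wtau' le] := window_extension nper wtau.
  apply: leq_trans le _.
  by have [_] := max_pattern_complexityP alpha (ltn0Sn k); apply.
have p1 : l <= max_pattern_complexity alpha 1.
  by rewrite -card_letters max_pattern_complexity1.
(* Makes the truncated subtraction of [2 * k] below exact. *)
have lower k : 0 < k -> 2 * k <= max_pattern_complexity alpha k.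
  by elim: k => // -[|k] IH _; [lia|have := step k.+1 isT; have := IH isT; lia].
have [||C [K [K0 C1 gC]]] := @nondecreasing_bounded_eventually_constant
  (fun k => max_pattern_complexity alpha k - 2 * k) m.
- by move=> k k0; have := step k k0; have := lower k k0; lia.
- by move=> k k0; have := upper k k0; lia.
(* Both bounds on [C] come from the value at [k = 1], which is at least [l - 2 >= 1]. *)
exists C, K; split=> //; [lia|lia|move=> k Kk].
have k0 : 0 < k by lia.
by have := gC k Kk; have := lower k k0; lia.
Qed.
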